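(* Let $S\subset\mathbb{Z}^d$ be finite (possibly containing $0$), $\mathcal{P}=\{P_\alpha\}_{\alpha\in S}$ a resolution of unity on $\mathbb{C}^D$, and $C$ a $D\times D$ unitary matrix with $C^2=I$ that is not a scalar multiple of the identity. Then: (a) $U(S,\mathcal{P},C)$ has eigenvalue $1$ if and only if for each $z\in T^d\setminus E$ there is a nonzero $\psi\in\mathcal{E}(1)$ with $\eta(z)\psi\in\mathcal{E}(-1)$; (b) $U(S,\mathcal{P},C)$ has eigenvalue $-1$ if and only if for each $z\in T^d\setminus E$ there is a nonzero $\psi\in\mathcal{E}(-1)$ with $\eta(z)\psi\in\mathcal{E}(1)$.
   Context: A resolution of unity: orthogonal projections $P_\alpha$ on $\mathbb{C}^D$, $P_\alpha P_\beta=0$ ($\alpha\neq\beta$), $\sum_\alpha P_\alpha=I$. $(\tau^\alpha f)(x)=f(x-\alpha)$ on $\ell^2(\mathbb{Z}^d,\mathbb{C}^D)$, $U(S,\mathcal{P},C)=\big(\sum_{\alpha\in S}\tau^\alpha P_\alpha\big)C$ with $C$ acting pointwise; eigenvalue means point spectrum. $T^d=\{z\in\mathbb{C}^d:|z_j|=1\}$, $z^\alpha=\prod z_j^{\alpha_j}$. $\mathcal{E}(\pm1)$ are the eigenspaces of $C$ for $\pm1$. $E=\bigcup_{\alpha\in S}\{z\in T^d:z^\alpha=-1\}$ and, for $z\in T^d\setminus E$, $\eta(z)=\sum_{\alpha\in S}\frac{1-z^\alpha}{1+z^\alpha}P_\alpha$. *)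

(* Defs.v *)
From Stdlib Require Import Reals ZArith List.
Import ListNotations.
Open Scope R_scope.

Record Cx := Cmk { Cre : R; Cim : R }.
Definition Czero : Cx := Cmk 0 0.
Definition Cone : Cx := Cmk 1 0.
Definition Cadd (a b : Cx) : Cx := Cmk (Cre a + Cre b) (Cim a + Cim b).
Definition Copp (a : Cx) : Cx := Cmk (- Cre a) (- Cim a).
Definition Csub (a b : Cx) : Cx := Cadd a (Copp b).
Definition Cmul (a b : Cx) : Cx :=
  Cmk (Cre a * Cre b - Cim a * Cim b) (Cre a * Cim b + Cim a * Cre b).
Definition Cconj (a : Cx) : Cx := Cmk (Cre a) (- Cim a).
Definition Cabs2 (a : Cx) : R := Cre a * Cre a + Cim a * Cim a.
Definition Cinv (a : Cx) : Cx := Cmk (Cre a / Cabs2 a) (- Cim a / Cabs2 a).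
Definition Cdiv (a b : Cx) : Cx := Cmul a (Cinv b).
Fixpoint Cpow (a : Cx) (n : nat) : Cx :=
  match n with O => Cone | S n => Cmul a (Cpow a n) end.
Definition Cpowz (a : Cx) (k : Z) : Cx :=
  match k with
  | Z0 => Cone
  | Zpos p => Cpow a (Pos.to_nat p)
  | Zneg p => Cinv (Cpow a (Pos.to_nat p))
  end.

(** * Vectors in C^D and D x D matrices (entries with indices < D matter) *)
Definition Vec := nat -> Cx.
Definition Mat := nat -> nat -> Cx.

Fixpoint csum (n : nat) (f : nat -> Cx) : Cx :=
  match n with O => Czero | S n => Cadd (csum n f) (f n) end.
Fixpoint rsum (n : nat) (f : nat -> R) : R :=
  match n with O => 0 | S n => rsum n f + f n end.

Definition mv (D : nat) (A : Mat) (v : Vec) : Vec :=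
  fun i => csum D (fun j => Cmul (A i j) (v j)).
Definition mm (D : nat) (A B : Mat) : Mat :=
  fun i k => csum D (fun j => Cmul (A i j) (B j k)).
Definition madj (A : Mat) : Mat := fun i j => Cconj (A j i).
Definition Ident : Mat := fun i j => if Nat.eqb i j then Cone else Czero.
Definition Zero : Mat := fun _ _ => Czero.
Definition scalmat (c : Cx) : Mat := fun i j => if Nat.eqb i j then c else Czero.
Definition madd (A B : Mat) : Mat := fun i j => Cadd (A i j) (B i j).
Definition mscale (c : Cx) (A : Mat) : Mat := fun i j => Cmul c (A i j).
Definition vadd (v w : Vec) : Vec := fun i => Cadd (v i) (w i).
Definition vscale (c : Cx) (v : Vec) : Vec := fun i => Cmul c (v i).
Definition vzero : Vec := fun _ => Czero.

Definition meq (D : nat) (A B : Mat) : Prop :=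
  forall i j, (i < D)%nat -> (j < D)%nat -> A i j = B i j.
Definition veq (D : nat) (v w : Vec) : Prop :=
  forall i, (i < D)%nat -> v i = w i.
Definition vnonzero (D : nat) (v : Vec) : Prop :=
  exists i, (i < D)%nat /\ v i <> Czero.
Definition vnorm2 (D : nat) (v : Vec) : R := rsum D (fun i => Cabs2 (v i)).

Definition unitary (D : nat) (A : Mat) : Prop :=
  meq D (mm D (madj A) A) Ident /\ meq D (mm D A (madj A)) Ident.
Definition orth_proj (D : nat) (P : Mat) : Prop :=
  meq D (mm D P P) P /\ meq D (madj P) P.
Definition is_scalar (D : nat) (A : Mat) : Prop :=
  exists c : Cx, meq D A (scalmat c).

Definition Zd := list Z.
Definition in_Zd (d : nat) (x : Zd) : Prop := length x = d.
Fixpoint zsub (x a : Zd) : Zd :=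
  match x, a with
  | x0 :: x', a0 :: a' => (x0 - a0)%Z :: zsub x' a'
  | _, _ => x
  end.

Definition finite_subset (d : nat) (S : list Zd) : Prop :=
  NoDup S /\ Forall (in_Zd d) S.

Definition msum_list {A : Type} (S : list A) (F : A -> Mat) : Mat :=
  fold_right (fun a acc => madd (F a) acc) Zero S.
Definition vsum_list {A : Type} (S : list A) (F : A -> Vec) : Vec :=
  fold_right (fun a acc => vadd (F a) acc) vzero S.

Definition resolution_of_unity (D : nat) (S : list Zd) (P : Zd -> Mat) : Prop :=
  (forall a, In a S -> orth_proj D (P a)) /\
  (forall a b, In a S -> In b S -> a <> b -> meq D (mm D (P a) (P b)) Zero) /\
  meq D (msum_list S P) Ident.

Definition Fld := Zd -> Vec.
Definition l2 (d D : nat) (f : Fld) : Prop :=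
  exists M : R, forall L : list Zd, NoDup L -> Forall (in_Zd d) L ->
    fold_right (fun x acc => vnorm2 D (f x) + acc) 0 L <= M.
Definition fnonzero (d D : nat) (f : Fld) : Prop :=
  exists x, in_Zd d x /\ vnonzero D (f x).

(** U(S,P,C) f = sum_{alpha in S} tau^alpha P_alpha C f,
    with (tau^alpha g)(x) = g(x - alpha) *)
Definition Uop (D : nat) (S : list Zd) (P : Zd -> Mat) (Cm : Mat) (f : Fld) : Fld :=
  fun x => vsum_list S (fun a => mv D (P a) (mv D Cm (f (zsub x a)))).

Definition has_eigenvalue (d D : nat) (S : list Zd) (P : Zd -> Mat) (Cm : Mat)
    (lam : Cx) : Prop :=
  exists f : Fld, l2 d D f /\ fnonzero d D f /\
    forall x, in_Zd d x -> veq D (Uop D S P Cm f x) (vscale lam (f x)).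

Definition in_torus (d : nat) (z : nat -> Cx) : Prop :=
  forall j, (j < d)%nat -> Cabs2 (z j) = 1.
Fixpoint zmon_aux (z : nat -> Cx) (j : nat) (a : Zd) : Cx :=
  match a with
  | [] => Cone
  | k :: a' => Cmul (Cpowz (z j) k) (zmon_aux z (S j) a')
  end.
Definition zmon (z : nat -> Cx) (a : Zd) : Cx := zmon_aux z 0 a.
Definition in_E (S : list Zd) (z : nat -> Cx) : Prop :=
  exists a, In a S /\ zmon z a = Copp Cone.
Definition eta (S : list Zd) (P : Zd -> Mat) (z : nat -> Cx) : Mat :=
  msum_list S (fun a =>
    mscale (Cdiv (Csub Cone (zmon z a)) (Cadd Cone (zmon z a))) (P a)).

Definition in_eigsp (D : nat) (Cm : Mat) (lam : Cx) (psi : Vec) : Prop :=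
  veq D (mv D Cm psi) (vscale lam psi).

(* Main.v *)
(* The Cayley transform turns the condition on [eta z] at a point [z] outside [E]
   into the existence of a vector fixed by [V(z) C], where [V(z)] is the sum of
   the [z^a P_a]; part (b) is part (a) for [- C].  Both properties, "U has an
   l^2 eigenfunction" and "V(z) C has a fixed vector for every z", are then
   shown to be equivalent to the existence of a finitely supported
   eigenfunction, by comparing the volume [n^d] of a large box with the
   [O(n^(d-1))] points near its boundary:
   - an eigenfunction on all of Z^d (not necessarily l^2) which vanishes near
     the boundary of a box can be cut off to that box;
   - from fixed vectors: if [n] is odd, no point whose coordinates are [n]-th
     roots of unity lies in [E], and the corresponding [n^d] plane waves are
     independent on the box, so some combination vanishes near the boundary but
     not on the box;
   - from an l^2 eigenfunction [f]: the restrictions to the box of its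
     translates span a space of dimension at least a constant times [n^d], by
     |tr M|^2 <= rank M * ||M||_F^2 for the matrix [M = (f (x0 + y - x))];
   - from a finitely supported eigenfunction [h] to a fixed vector at [z]: the
     lowest nonvanishing moment of [x |-> z^x h(x)] along a generic linear form. *)
Require Import Defs.
From Stdlib Require Import Reals ZArith List Classical FunctionalExtensionality.
From mathcomp Require Import all_boot all_order all_algebra all_field.
From mathcomp Require Import zify ssrZ ring complex Rstruct.
Set Implicit Arguments. Unset Strict Implicit. Unset Printing Implicit Defensive.
Import Order.TTheory GRing.Theory Num.Theory.
Local Open Scope ring_scope.

(** * Rank and trace *)

Section Rank.
Variable C : numClosedFieldType.
Local Open Scope sesquilinear_scope.

Lemma mxtrace_mul_adj m n (E : 'M[C]_(m, n)) :
  \tr (E *m E^t*) = \sum_i \sum_j `|E i j| ^+ 2.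
Proof.
rewrite /mxtrace; apply: eq_bigr => i _; rewrite mxE; apply: eq_bigr => j _.
by rewrite !mxE -normCK.
Qed.

Lemma mxtrace_adj n (E : 'M[C]_n) : \tr (E^t*) = (\tr E)^*.
Proof. by rewrite trace_map_mx mxtrace_tr. Qed.

Lemma adj_mulmx m n p (A : 'M[C]_(m, n)) (B : 'M[C]_(n, p)) :
  (A *m B)^t* = B^t* *m A^t*.
Proof. by rewrite trmx_mul map_mxM. Qed.

(* Nonnegativity of the Frobenius norm of [M - (tr M / r) Pi], with [Pi] the
   orthogonal projection onto the row space of [M] and [r] its rank. *)
Lemma normC_trace_rank n (M : 'M[C]_n) :
  `|\tr M| ^+ 2 <= (\rank M)%:R * \sum_i \sum_j `|M i j| ^+ 2.
Proof.
set r := \rank M; set Q := schmidt (row_base M).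
have [r0 | r_gt0] := posnP r.
  have /eqP-> : M == 0 by rewrite -mxrank_eq0 -/r r0.
  rewrite mxtrace0 normr0 expr0n mulr_ge0 ?ler0n ?sumr_ge0 // => i _.
  by rewrite sumr_ge0 // => j _; rewrite exprn_ge0.
have QQ : Q *m Q^t* = 1%:M.
  by apply/unitarymxP; rewrite schmidt_unitarymx ?rank_leq_col.
have /submxP[B MB] : (M <= Q)%MS by rewrite eqmx_schmidt_free ?row_base_free // eq_row_base.
set Pi := Q^t* *m Q.
have MPi : M *m Pi = M by rewrite {1}MB /Pi mulmxA -(mulmxA B) QQ mulmx1 -MB.
have PiH : Pi^t* = Pi by rewrite /Pi adj_mulmx trmxCK.
have PiPi : Pi *m Pi = Pi by rewrite /Pi mulmxA -(mulmxA (Q^t*)) QQ mulmx1.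
have trPi : \tr Pi = r%:R by rewrite /Pi mxtrace_mulC QQ mxtrace1.
have trPiM : \tr (Pi *m M^t*) = (\tr M)^*.
  by rewrite -{1}PiH -adj_mulmx MPi mxtrace_adj.
set c := \tr M / r%:R.
have r0 : (r%:R : C) != 0 by rewrite pnatr_eq0 -lt0n.
have cC : c^* = (\tr M)^* / r%:R by rewrite /c rmorphM fmorphV rmorph_nat.
have : 0 <= \tr ((M - c *: Pi) *m (M - c *: Pi)^t*).
  by rewrite mxtrace_mul_adj sumr_ge0 // => i _; rewrite sumr_ge0 // => j _; rewrite exprn_ge0.
have -> : (M - c *: Pi)^t* = M^t* - c^* *: Pi.
  by rewrite -{2}PiH; apply/matrixP => i j; rewrite !mxE rmorphB rmorphM.
rewrite mulmxBl !mulmxBr -!scalemxAl -!scalemxAr MPi PiPi !raddfB /= !mxtraceZ.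
rewrite trPiM trPi mxtrace_mul_adj normCK cC /c.
set F := \sum_i _; set t := \tr M => H.
have Er :
  r%:R * (F - t^* / r%:R * t
          + (- (t / r%:R * t^*) - - (t / r%:R * (t^* / r%:R * r%:R))))
  = r%:R * F - t * t^* by field.
by rewrite -subr_ge0 -Er mulr_ge0 ?ler0n.
Qed.

Lemma sum_enum_val (T : finType) (F : T -> C) :
  \sum_t F t = \sum_(i < #|T|) F (enum_val i).
Proof. by rewrite -big_enum_val; apply: eq_bigl => t. Qed.

Lemma underdetermined (T K : finType) (a : K -> T -> C) : (#|K| < #|T|)%N ->
  exists2 c : T -> C, (exists t, c t != 0) & forall k, \sum_t a k t * c t = 0.
Proof.
move=> KT; pose L := \matrix_(t < #|T|, k < #|K|) a (enum_val k) (enum_val t).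
have : kermx L != 0.
  rewrite -mxrank_eq0 mxrank_ker subn_eq0 -ltnNge.
  exact: leq_ltn_trans (rank_leq_col _) KT.
case/rowV0Pn => v /sub_kermxP vL /rV0Pn[j vj].
exists (fun t => v 0 (enum_rank t)); first by exists (enum_val j); rewrite enum_valK.
move=> k; have /rowP/(_ (enum_rank k)) := vL; rewrite !mxE => {2}<-.
by rewrite sum_enum_val; apply: eq_bigr => i _; rewrite !mxE enum_valK enum_rankK mulrC.
Qed.

(** The hypothesis puts the kernel of the constraints inside the kernel of [M], so the rank of [M]
    is at most [#|K|] and [normC_trace_rank] applies. *)
Lemma normC_trace_constraints (T K : finType) (M : T -> T -> C) (a : K -> T -> C) :
    (forall c : T -> C, (forall k, \sum_t a k t * c t = 0) ->
       forall s, \sum_t M s t * c t = 0) ->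
  `|\sum_t M t t| ^+ 2 <= #|K|%:R * \sum_s \sum_t `|M s t| ^+ 2.
Proof.
move=> aM.
pose L := \matrix_(t < #|T|, k < #|K|) a (enum_val k) (enum_val t).
pose N := \matrix_(t < #|T|, s < #|T|) M (enum_val s) (enum_val t).
have rkN : (\rank N <= #|K|)%N.
  have : (kermx L <= kermx N)%MS.
    apply/rV_subP => v /sub_kermxP vL; apply/sub_kermxP/rowP => s; rewrite !mxE.
    rewrite -[RHS](aM (fun t => v 0 (enum_rank t)) _ (enum_val s)).
      by rewrite [RHS]sum_enum_val; apply: eq_bigr => i _; rewrite !mxE enum_valK mulrC.
    move=> k; have /rowP/(_ (enum_rank k)) := vL; rewrite !mxE => {2}<-.
    by rewrite sum_enum_val; apply: eq_bigr => i _; rewrite !mxE enum_valK enum_rankK mulrC.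
  (* Ranks of kernels are truncated differences from [#|T|], hence the row bounds supplied to
     [lia]. *)
  move/mxrankS; rewrite !mxrank_ker => H.
  have := rank_leq_col L; have := rank_leq_row L; have := rank_leq_row N.
  by move: (\rank L) (\rank N) H => x y; lia.
have := normC_trace_rank N.
have -> : \tr N = \sum_t M t t.
  by rewrite [RHS]sum_enum_val; apply: eq_bigr => i _; rewrite mxE.
have -> : \sum_i \sum_j `|N i j| ^+ 2 = \sum_s \sum_t `|M s t| ^+ 2.
  rewrite [RHS]sum_enum_val exchange_big; apply: eq_bigr => i _; rewrite [RHS]sum_enum_val.
  by apply: eq_bigr => j _; rewrite mxE.
move/le_trans; apply; rewrite ler_wpM2r ?ler_nat //.
by rewrite sumr_ge0 // => s _; rewrite sumr_ge0 // => t _; rewrite exprn_ge0.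
Qed.

End Rank.

(** * Translation-invariant equations on the lattice *)

Notation lattice d := {ffun 'I_d -> int}.

Section Lattice.
Variables (C : numClosedFieldType) (d D : nat).
Implicit Types (x y a : lattice d) (z : 'I_d -> C) (S s t : seq (lattice d)).
Implicit Types (A : lattice d -> 'M[C]_D) (f F h : lattice d -> 'cV[C]_D).

Definition monomial z a : C := \prod_j z j ^ a j.

(** This is U f = f with [A a] in the role of P_a C; an eigenvalue -1 is absorbed into [A]. *)
Definition stationary S A f := forall x, f x = \sum_(a <- S) A a *m f (x - a).

Definition symbol S A z := \sum_(a <- S) monomial z a *: A a.

Definition in_box (lo hi : int) x := [forall j, lo <= x j < hi].

Lemma monomialD z x y : (forall j, z j != 0) ->
  monomial z (x + y) = monomial z x * monomial z y.
Proof.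
move=> z0; rewrite -big_split; apply: eq_bigr => j _.
by rewrite ffunE expfzDr.
Qed.

Lemma monomial_neq0 z x : (forall j, z j != 0) -> monomial z x != 0.
Proof. by move=> z0; apply/prodf_neq0 => j _; rewrite expfz_neq0. Qed.

(* The zero layer of width [2m] shields the truncated function from the values
   of [F] outside the large box, since shifts move points by at most [m]. *)
Lemma stationary_truncate S A F (m n : nat) :
    (forall a j, a \in S -> - m%:Z <= a j <= m%:Z) ->
    stationary S A F ->
    (forall x, in_box 0 n x -> ~~ in_box m.*2 (n%:Z - m.*2%:Z) x -> F x = 0) ->
  stationary S A (fun x => if in_box m.*2 (n%:Z - m.*2%:Z) x then F x else 0).
Proof.
move=> mS statF F0 x.
have hF y : in_box 0 n y ->
    (if in_box m.*2 (n%:Z - m.*2%:Z) y then F y else 0) = F y.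
  by move=> yn; case: ifPn => // /F0-> //.
have [xm | xNm] := boolP (in_box m (n%:Z - m%:Z) x).
  rewrite hF; last by apply/forallP => j; have /forallP/(_ j) := xm; lia.
  rewrite statF; apply: eq_big_seq => a aS; rewrite hF //.
  apply/forallP => j; rewrite !ffunE; have := mS _ j aS.
  have /forallP/(_ j) := xm; move: (x j) (a j) => u v; lia.
rewrite ifN; last first.
  apply: contra xNm => /forallP xi; apply/forallP => j; have := xi j; lia.
rewrite big1_seq // => a /andP[_ aS]; rewrite ifN ?mulmx0 //.
apply: contra xNm => /forallP xi; apply/forallP => j; have := xi j.
by rewrite !ffunE; have := mS _ j aS; move: (x j) (a j) => u v; lia.
Qed.

Lemma big_support_seq (V : nmodType) s t (g : lattice d -> V) :
    uniq s -> uniq t -> {subset s <= t} -> (forall x, x \notin s -> g x = 0) ->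
  \sum_(x <- t) g x = \sum_(x <- s) g x.
Proof.
move=> us ut st g0; rewrite (bigID (mem s)) /= [X in _ + X]big1 ?addr0 //.
rewrite -big_filter; apply: perm_big; apply: uniq_perm; rewrite ?filter_uniq //.
by move=> x; rewrite mem_filter; case: (boolP (x \in s)) => //= /st.
Qed.

(** The form is x |-> sum_j x_j w^j. Each nonzero difference x - y gives a nonzero polynomial
    [q (x - y)], and [w] has to avoid the finitely many roots of their product. *)
Lemma separating_form s :
  exists2 l : lattice d -> C, {morph l : x y / x + y} & {in s &, injective l}.
Proof.
pose q x : {poly C} := \sum_j (x j)%:~R *: 'X^j.
have q_eq0 x : q x = 0 -> x = 0.
  move=> qx; apply/ffunP => j; rewrite ffunE; apply/eqP.
  rewrite -(intr_eq0 C); have /polyP/(_ j) := qx.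
  rewrite coef0 coef_sum (bigD1 j) //= big1 => [|i ij].
    by rewrite coefZ coefXn eqxx mulr1 addr0 => ->.
  by rewrite coefZ coefXn eq_sym [_ == _](negbTE ij) mulr0.
have qB x y : q (x - y) = q x - q y.
  by rewrite -sumrB; apply: eq_bigr => j _; rewrite !ffunE intrB scalerBl.
have qD x y : q (x + y) = q x + q y.
  by rewrite -big_split; apply: eq_bigr => j _; rewrite !ffunE intrD scalerDl.
pose p := \prod_(u <- [seq x - y | x <- s, y <- s] | u != 0) q u.
have p0 : p != 0.
  by rewrite prodf_seq_neq0; apply/allP => u _; apply/implyP; apply: contra => /eqP/q_eq0->.
have [w pw] : exists w, ~~ root p w.
  (* These [size p] integers are distinct in characteristic 0, too many to be all roots of [p]. *)
  pose rs : seq C := [seq i%:R | i <- iota 0 (size p)].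
  have [/(max_poly_roots p0)|/allPn[w _ ?]] := boolP (all (root p) rs); last by exists w.
  rewrite map_inj_uniq ?iota_uniq; last by move=> i j /eqP; rewrite eqr_nat => /eqP.
  by rewrite size_map size_iota ltnn => /(_ isT).
exists (fun x => (q x).[w]) => [x y | x y xs ys /eqP]; first by rewrite qD hornerD.
rewrite -subr_eq0 -hornerN -hornerD -qB => /eqP qw.
apply/eqP; rewrite -subr_eq0; apply: contraNT pw => xy.
rewrite /root horner_prod prodf_seq_eq0; apply/hasP; exists (x - y).
  by apply/allpairsP; exists (x, y).
by rewrite xy qw eqxx.
Qed.

(* The lowest nonvanishing moment of [z^x h(x)] along a separating linear form
   is fixed by the symbol, since the cross terms of a shift only involve lower
   moments. *)
Lemma symbol_fixed_vector S A h s z :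
    (forall j, z j != 0) -> stationary S A h ->
    (forall x, x \notin s -> h x = 0) -> (exists x, h x != 0) ->
  exists2 phi : 'cV[C]_D, phi != 0 & phi = symbol S A z *m phi.
Proof.
move=> z0 stat_h; wlog us : s / uniq s => [IH hs|hs [x0 hx0]].
  by apply: (IH (undup s)); rewrite ?undup_uniq // => x; rewrite mem_undup; apply: hs.
have [l lD l_inj] := separating_form s.
pose mu k : 'cV[C]_D := \sum_(x <- s) (l x ^+ k * monomial z x) *: h x.
have x0s : x0 \in s by apply: contraR hx0 => /hs->.
have [k muk] : exists k, mu k != 0.
  (* [p] vanishes at the values of [l] on all points of [s] but [x0]. If all moments of order below
     [size p] were zero, their combination with the coefficients of [p] would be both zero and a
     nonzero multiple of [h x0]. *)
  pose p := \prod_(y <- s | y != x0) ('X - (l y)%:P).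
  have [/forallP mu0|] := boolP [forall k : 'I_(size p), mu k == 0]; last first.
    by rewrite negb_forall => /existsP[k ?]; exists k.
  have : \sum_(x <- s) (p.[l x] * monomial z x) *: h x = 0.
    transitivity (\sum_(k < size p) p`_k *: mu k).
      under [RHS]eq_bigr do rewrite scaler_sumr.
      rewrite exchange_big; apply: eq_bigr => x _; rewrite horner_coef.
      rewrite mulr_suml scaler_suml; apply: eq_bigr => i _.
      by rewrite scalerA mulrA.
    by rewrite big1 // => i _; rewrite (eqP (mu0 i)) scaler0.
  rewrite (bigD1_seq x0) //= big_seq_cond big1 => [|x /andP[xs xx0]]; last first.
    suff -> : p.[l x] = 0 by rewrite mul0r scale0r.
    apply/eqP; rewrite horner_prod prodf_seq_eq0; apply/hasP; exists x => //.
    by rewrite xx0 hornerXsubC subrr eqxx.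
  rewrite addr0 => /eqP; rewrite scaler_eq0 (negbTE hx0) orbF mulf_eq0.
  rewrite (negbTE (monomial_neq0 _ z0)) orbF horner_prod prodf_seq_eq0.
  case/hasP => y ys /andP[yx0]; rewrite hornerXsubC subr_eq0 => /eqP/l_inj.
  by move=> /(_ x0s ys) yx; rewrite yx eqxx in yx0.
have [j muj j_min] := ex_minnP (ex_intro (fun k => mu k != 0) k muk).
exists (mu j) => //.
(* [t] contains [s] and its translates by [S], so sums over any of these can be written over [t]. *)
pose t := undup (s ++ [seq x + a | a <- S, x <- s]).
have st : {subset s <= t} by move=> x xs; rewrite mem_undup mem_cat xs.
pose c x := l x ^+ j * monomial z x.
transitivity (\sum_(x <- t) c x *: h x).
  by rewrite (big_support_seq us) ?undup_uniq // => x /hs->; rewrite scaler0.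
transitivity (\sum_(a <- S) A a *m \sum_(y <- s) c (y + a) *: h y).
  transitivity (\sum_(a <- S) A a *m \sum_(x <- t) c x *: h (x - a)).
    under eq_bigr => x _ do rewrite stat_h scaler_sumr.
    rewrite exchange_big; apply: eq_bigr => a _; rewrite mulmx_sumr.
    by apply: eq_bigr => x _; rewrite scalemxAr.
  apply: eq_big_seq => a aS; congr (_ *m _).
  rewrite (@big_support_seq _ [seq y + a | y <- s]) ?undup_uniq //.
  - by rewrite big_map; apply: eq_bigr => y _; rewrite addrK.
  - by rewrite map_inj_uniq //; apply: addIr.
  - move=> _ /mapP[y ys ->]; rewrite mem_undup mem_cat; apply/orP; right.
    by apply/allpairsP; exists (a, y).
  - move=> x xNs; rewrite hs ?scaler0 //; apply: contra xNs => xs.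
    by apply/mapP; exists (x - a); rewrite ?subrK.
rewrite /symbol mulmx_suml; apply: eq_bigr => a _; rewrite -scalemxAl scalemxAr.
congr (_ *m _).
(* Binomial expansion of (l y + l a)^j: the term i = 0 yields the moment of order j, and the terms i
   > 0 involve lower moments, zero by minimality of j. *)
transitivity (\sum_(i < j.+1)
    ('C(j, i)%:R * l a ^+ i * monomial z a) *: mu (j - i)%N).
  under [RHS]eq_bigr do rewrite scaler_sumr.
  rewrite exchange_big; apply: eq_bigr => y _.
  rewrite /c lD exprDn monomialD // !mulr_suml scaler_suml; apply: eq_bigr => i _.
  by rewrite scalerA -mulr_natl; congr (_ *: _); ring.
rewrite big_ord_recl big1 => [|i _].
  by rewrite bin0 expr0 !mul1r subn0 addr0.
apply/eqP; rewrite scaler_eq0; apply/orP; right.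
apply/negbNE/negP => /j_min; rewrite lift0 leqNgt ltn_subrL /=.
by rewrite (leq_ltn_trans _ (ltn_ord i)).
Qed.

End Lattice.

(** * Lattice points near the boundary of a box *)

Section Counting.
Variable d : nat.

Definition corner n (b : {ffun 'I_d -> 'I_n}) : lattice d := [ffun j => (b j : nat)%:Z].

Lemma corner_inj n : injective (@corner n).
Proof.
move=> b c /ffunP bc; apply/ffunP => j; apply/val_inj.
by have := bc j; rewrite !ffunE => -[].
Qed.

Lemma in_box_corner (n : nat) (x : lattice d) :
  in_box 0 n x -> exists b : {ffun 'I_d -> 'I_n}, x = corner b.
Proof.
move=> /forallP xn.
have xnj j : (`|x j|%N < n)%N by have := xn j; move: (x j) => u; lia.
exists [ffun j => Ordinal (xnj j)]; apply/ffunP => j; rewrite !ffunE /=.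
by have := xn j; move: (x j) => u; lia.
Qed.

Definition outer n m (b : {ffun 'I_d -> 'I_n}) :=
  ~~ in_box m.*2 (n%:Z - m.*2%:Z) (corner b).

(** Union bound over the coordinate that lies within 2m of an end: at most 4m values for it and
    n^(d-1) choices for the others. The factor [n] on the left avoids the exponent d - 1. *)
Lemma card_outer n m : (#|@outer n m| * n <= 4 * m * d * n ^ d)%N.
Proof.
pose bad (k : nat) : bool := (k < m.*2)%N || (n < k + m.*2 + 1)%N.
have outerE (b : {ffun 'I_d -> 'I_n}) : (outer m b <= \sum_j bad (b j : nat))%N.
  case: (boolP (outer m b)) => // /forallPn[j bj]; rewrite (bigD1 j) //=.
  suff -> : bad (b j) by [].
  by move: bj; rewrite ffunE /bad; have := ltn_ord (b j); move: (nat_of_ord _) => u; lia.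
have badE : (\sum_(k < n) bad k <= 4 * m)%N.
  have low N : (\sum_(k < N) (k < m.*2) <= minn N m.*2)%N.
    elim: N => [|N]; rewrite ?big_ord0 // big_ord_recr /=.
    by case: ltnP; move: (\sum_(_ < N) _)%N => u; lia.
  have high N : (\sum_(k < N) (n < k + m.*2 + 1) <= N + m.*2 - n)%N.
    elim: N => [|N]; rewrite ?big_ord0 // big_ord_recr /=.
    by case: ltnP; move: (\sum_(_ < N) _)%N => u; lia.
  apply: (@leq_trans (\sum_(k < n) ((k < m.*2) + (n < k + m.*2 + 1)))%N).
    by apply: leq_sum => k _; rewrite /bad; lia.
  by rewrite big_split; apply: leq_trans (leq_add (low n) (high n)) _; lia.
have sumE j : ((\sum_(b : {ffun 'I_d -> 'I_n}) bad (b j)) * n <= 4 * m * n ^ d)%N.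
  (* The indicator is written as a product over the coordinates, so that the sum over the box
     factors. *)
  pose F (i : 'I_d) (k : 'I_n) : nat := if i == j then (bad k : nat) else 1%N.
  have -> : (\sum_(b : {ffun 'I_d -> 'I_n}) bad (b j) =
             \sum_(b : {ffun 'I_d -> 'I_n}) \prod_i F i (b i))%N.
    apply: eq_bigr => b _; rewrite (bigD1 j) //= big1 ?muln1 /F ?eqxx //.
    by move=> i /negbTE ->.
  rewrite -bigA_distr_bigA (bigD1 j) //= {1}/F eqxx.
  have -> : (\prod_(i | i != j) \sum_k F i k = \prod_(i | i != j) n)%N.
    apply: eq_bigr => i /negbTE ij.
    by rewrite (eq_bigr (fun=> 1%N)) ?sum1_card ?card_ord // => k _; rewrite /F ij.
  rewrite prod_nat_const -mulnA -expnSr (cardC1 j) card_ord prednK ?leq_mul //.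
  exact: leq_ltn_trans (ltn_ord j).
rewrite -sum1_card big_mkcond /=.
apply: (@leq_trans (\sum_j ((\sum_(b : {ffun 'I_d -> 'I_n}) bad (b j)) * n))).
  rewrite -big_distrl leq_mul // exchange_big; apply: leq_sum => b _.
  by apply: leq_trans (outerE b); rewrite -[b \in _]/(outer m b); case: outer.
apply: (@leq_trans (\sum_(j < d) 4 * m * n ^ d)).
  by apply: leq_sum => j _; apply: sumE.
by rewrite sum_nat_const card_ord; lia.
Qed.

End Counting.

(** * Construction of finitely supported eigenfunctions *)

Section Eigenfunctions.
Variables (C : numClosedFieldType) (d D : nat).
Implicit Types (x y a : lattice d) (z : 'I_d -> C) (S s : seq (lattice d)).
Implicit Types (A : lattice d -> 'M[C]_D) (f h : lattice d -> 'cV[C]_D).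

Definition has_finite_stationary S A := exists h s,
  [/\ stationary S A h, forall x, x \notin s -> h x = 0 & exists x, h x != 0].

Lemma stationary_sum (T : finType) S A (g : T -> lattice d -> 'cV[C]_D) (c : T -> C) :
  (forall t, stationary S A (g t)) -> stationary S A (fun x => \sum_t c t *: g t x).
Proof.
move=> gP x; under [RHS]eq_bigr do rewrite mulmx_sumr.
rewrite exchange_big; apply: eq_bigr => t _; rewrite gP scaler_sumr.
by apply: eq_bigr => a _; rewrite scalemxAr.
Qed.

Lemma stationary_shift S A f x : stationary S A f -> stationary S A (fun y => f (x + y)).
Proof. by move=> fP y; rewrite fP; apply: eq_bigr => a _; rewrite addrA. Qed.

Lemma stationary_plane_wave S A z (phi : 'cV[C]_D) :
    (forall j, z j != 0) -> phi = symbol S A z *m phi ->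
  stationary S A (fun x => monomial z (- x) *: phi).
Proof.
move=> z0 phiP x; rewrite {1}phiP /symbol mulmx_suml scaler_sumr.
apply: eq_bigr => a _; rewrite opprB addrC monomialD //.
by rewrite -scalemxAl -scalemxAr scalerA.
Qed.

Lemma shift_bound S : exists m : nat, forall a j, a \in S -> - m%:Z <= a j <= m%:Z.
Proof.
exists (\sum_(a <- S) \sum_j `|a j|%N)%N => a j aS.
have : (`|a j| <= \sum_(a <- S) \sum_j `|a j|)%N.
  rewrite (big_rem a) //= (bigD1 j) //= -addnA; exact: leq_addr.
by move: (a j) (\sum_(a <- S) _)%N => u v; lia.
Qed.

(** Indexes the scalar equations that make a vector-valued function vanish at the outer points of
    the box: one for each point and component. *)
Definition boundary n m := ({b : {ffun 'I_d -> 'I_n} | outer m b} * 'I_D)%type.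

Lemma card_boundary n m : (#|{: boundary n m}| * n <= 4 * m * d * D * n ^ d)%N.
Proof.
rewrite card_prod card_sig card_ord mulnAC (mulnAC _ D) leq_mul //.
by apply: leq_trans (card_outer d n m); rewrite leq_mul.
Qed.

(** Shared last step of the constructions from plane waves and from translates: the combination
    vanishes near the boundary of the box, so it can be cut off there, and [b0] witnesses that the
    result is nonzero. *)
Lemma finite_stationary_of_combination (n m : nat) S A
    (g : {ffun 'I_d -> 'I_n} -> lattice d -> 'cV[C]_D)
    (c : {ffun 'I_d -> 'I_n} -> C) (b0 : {ffun 'I_d -> 'I_n}) :
    (forall a j, a \in S -> - m%:Z <= a j <= m%:Z) ->
    (forall t, stationary S A (g t)) ->
    (forall k : boundary n m, \sum_t g t (corner (val k.1)) k.2 0 * c t = 0) ->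
    \sum_t c t *: g t (corner b0) != 0 ->
  has_finite_stationary S A.
Proof.
move=> mS gP gc Fb0; pose F x := \sum_t c t *: g t x.
have F0 x : in_box 0 n x -> ~~ in_box m.*2 (n%:Z - m.*2%:Z) x -> F x = 0.
  case/in_box_corner => b -> outb; apply/matrixP => i j; rewrite (ord1 j) mxE.
  rewrite -[RHS](gc (exist _ b outb, i)) summxE.
  by apply: eq_bigr => t _; rewrite mxE mulrC.
exists (fun x => if in_box m.*2 (n%:Z - m.*2%:Z) x then F x else 0).
exists (codom (@corner d n)); split.
- by apply: stationary_truncate => //; apply: stationary_sum.
- move=> x xNn; case: ifP => // /forallP xi.
  have [] := @in_box_corner d n x => [|b xb]; last by rewrite xb codom_f in xNn.
  by apply/forallP => j; have := xi j; move: (x j) => u; lia.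
- exists (corner b0); case: ifPn => // ob; case/eqP: Fb0; apply: F0 => //.
  by apply/forallP => j; rewrite ffunE; have := ltn_ord (b0 j); move: (nat_of_ord _) => u; lia.
Qed.

Lemma unity_roots n : (0 < n)%N ->
  exists2 r : 'I_n -> C, injective r & forall i, r i ^+ n = 1.
Proof.
move=> n0; have [rs] := closed_field_poly_normal ('X^n - 1 : {poly C}).
rewrite (monicP (monicXnsubC 1 n0)) scale1r => rsE.
have urs : uniq rs.
  rewrite -separable_prod_XsubC -rsE separable_Xn_sub_1 //.
  by rewrite pnatr_eq0 -lt0n.
have szrs : size rs = n.
  by apply: succn_inj; rewrite -(size_prod_XsubC rs id) -rsE size_XnsubC.
exists (fun i => nth 0 rs i) => [i j /eqP|i].
  by rewrite nth_uniq ?szrs // => /eqP/val_inj.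
have : root ('X^n - 1) (nth 0 rs i) by rewrite rsE root_prod_XsubC mem_nth ?szrs.
by rewrite /root !hornerE subr_eq0 => /eqP.
Qed.

(** The sum factors over the coordinates into geometric sums of the ratios [r (l j) / r (k j)]. Each
    ratio is an n-th root of unity, so its geometric sum vanishes unless the ratio is 1. *)
Lemma character_orthogonality n (r : 'I_n -> C) (k l : {ffun 'I_d -> 'I_n}) :
    injective r -> (forall i, r i ^+ n = 1) ->
  \sum_(b : {ffun 'I_d -> 'I_n})
     monomial (r \o l) (corner b) * monomial (r \o k) (- corner b) =
  if k == l then n%:R ^+ d else 0.
Proof.
move=> r_inj rn.
pose q j := r (l j) / r (k j).
transitivity (\prod_j \sum_(i < n) q j ^+ i).
  rewrite bigA_distr_bigA; apply: eq_bigr => b _; rewrite -big_split.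
  apply: eq_bigr => j _; rewrite !ffunE /= /q exprMn exprVn.
  by rewrite -exprnN.
have r0 i : r i != 0.
  apply: contra_eq_neq (rn i) => ->.
  by rewrite expr0n gtn_eqF ?(leq_ltn_trans _ (ltn_ord i)) // eq_sym oner_eq0.
have [kl|kl] := eqVneq k l.
  rewrite -[X in _ ^+ X]card_ord -prodr_const; apply: eq_bigr => j _.
  rewrite /q kl divff //.
  by under eq_bigr do rewrite expr1n; rewrite sumr_const card_ord.
have [j klj] : exists j, k j != l j.
  by apply/existsP; rewrite -negb_forall; apply: contra kl => /eqfunP/ffunP->.
apply/eqP/prodf_eq0; exists j => //.
have qn : q j ^+ n = 1 by rewrite /q exprMn exprVn !rn invr1 mulr1.
have := subrX1 (q j) n; rewrite qn subrr => /esym/eqP; rewrite mulf_eq0 => /orP[|//].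
rewrite subr_eq0 => /eqP q1; case/eqP: klj; apply: r_inj.
by rewrite -[r (l j)](divfK (r0 (k j))) -/(q j) q1 mul1r.
Qed.

Lemma finite_stationary_of_symbol S A :
    (forall n z, odd n -> (forall j, z j ^+ n = 1) ->
       exists2 phi : 'cV[C]_D, phi != 0 & phi = symbol S A z *m phi) ->
  has_finite_stationary S A.
Proof.
move=> hz; have [m mS] := shift_bound S.
(* [n] is odd, as [hz] requires, and exceeds 4mdD, so by [card_boundary] there are fewer boundary
   equations than the n^d plane waves. *)
pose n := (4 * m * d * D).*2.+1.
have [r r_inj rn] := unity_roots (isT : 0 < n)%N.
have r0 i : r i != 0.
  by apply: contra_eq_neq (rn i) => ->; rewrite expr0n eq_sym oner_eq0.
have hphi (k : {ffun 'I_d -> 'I_n}) :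
    exists phi : 'cV[C]_D, phi != 0 /\ phi = symbol S A (r \o k) *m phi.
  have [||phi ? ?] := hz n (r \o k); last by exists phi.
    by rewrite /n /= odd_double.
  by move=> j; apply: rn.
have [phi phiP] := fin_all_exists hphi.
pose g (k : {ffun 'I_d -> 'I_n}) x := monomial (r \o k) (- x) *: phi k.
pose cons (k : boundary n m) (t : {ffun 'I_d -> 'I_n}) := g t (corner (val k.1)) k.2 0.
have few : (#|{: boundary n m}| < #|{: {ffun 'I_d -> 'I_n}}|)%N.
  rewrite card_ffun !card_ord.
  have nd : (0 < n ^ d)%N by rewrite expn_gt0.
  have : (#|{: boundary n m}| * n < n ^ d * n)%N.
    apply: leq_ltn_trans (card_boundary n m) _.
    by rewrite mulnC ltn_pmul2l // /n; lia.
  by rewrite ltn_pmul2r.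
have [c [t ct] cP] := underdetermined cons few.
have gP k : stationary S A (g k).
  by apply: stationary_plane_wave => [j|]; [exact: r0 | have [] := phiP k].
have [b0 b0P|F0] := pickP (fun b : {ffun 'I_d -> 'I_n} => \sum_t c t *: g t (corner b) != 0).
  exact: finite_stationary_of_combination mS gP cP b0P.
(* If the combination vanished on the whole box, pairing it with the character of [t] would give n^d
   c_t phi_t = 0. *)
have : \sum_(b : {ffun 'I_d -> 'I_n})
    monomial (r \o t) (corner b) *: \sum_k c k *: g k (corner b) = 0.
  by apply: big1 => b _; have /negbFE/eqP-> := F0 b; rewrite scaler0.
under eq_bigr do rewrite scaler_sumr.
rewrite exchange_big (bigD1 t) //= [X in _ + X]big1 => [|k kt].
  under eq_bigr do rewrite /g !scalerA -mulrA mulrCA -scalerA.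
  rewrite -scaler_sumr -scaler_suml.
    rewrite character_orthogonality // eqxx addr0 => /eqP.
  by rewrite !scaler_eq0 (negbTE ct) expf_eq0 pnatr_eq0 andbF (negbTE (phiP t).1).
under eq_bigr do rewrite /g !scalerA -mulrA mulrCA -scalerA.
rewrite -scaler_sumr -scaler_suml.
by rewrite character_orthogonality // (negbTE kt) scale0r scaler0.
Qed.

(** Without a finitely supported solution, a combination of translates of [f] that satisfies the
    boundary equations must vanish on the box, so the matrix [M] has rank O(n^(d-1)). Its trace is
    n^d times an entry of f(x0), and its squared Frobenius norm is at most n^d B. Hence n times the
    squared modulus of that entry stays bounded, against the archimedean property. *)
Lemma finite_stationary_of_l2 S A f (B : C) :
    (forall x : C, 0 <= x -> exists n : nat, x < n%:R) ->
    stationary S A f ->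
    (forall s, uniq s -> \sum_(x <- s) \sum_i `|f x i 0| ^+ 2 <= B) ->
    (exists x, f x != 0) ->
  has_finite_stationary S A.
Proof.
move=> archi statf fB [x0 /cV0Pn[i0 fx0]]; have [m mS] := shift_bound S.
apply: NNPP => noh.
have B0 : 0 <= B by apply: le_trans (fB [::] isT); rewrite big_nil.
have bound (n : nat) : (0 < n)%N -> n%:R * `|f x0 i0 0| ^+ 2 <= (4 * m * d * D)%:R * B.
  move=> n0.
  pose g (b : {ffun 'I_d -> 'I_n}) y := f (x0 - corner b + y).
  have gP b : stationary S A (g b) by apply: stationary_shift.
  pose M (s t : {ffun 'I_d -> 'I_n}) := g t (corner s) i0 0.
  pose cons (k : boundary n m) (t : {ffun 'I_d -> 'I_n}) := g t (corner (val k.1)) k.2 0.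
  have trM : \sum_t M t t = (n ^ d)%:R * f x0 i0 0.
    under eq_bigr do rewrite /M /g subrK.
    by rewrite sumr_const card_ffun !card_ord mulr_natl.
  have tr : `|\sum_t M t t| ^+ 2 <= #|{: boundary n m}|%:R * \sum_s \sum_t `|M s t| ^+ 2.
    apply: (@normC_trace_constraints _ _ _ M cons) => c cP s.
    apply/eqP; apply: contraT => Ms; case: noh.
    apply: (finite_stationary_of_combination (b0 := s) mS gP cP).
    apply: contra_neq Ms => /matrixP/(_ i0 0); rewrite summxE mxE => {2}<-.
    by apply: eq_bigr => t _; rewrite mxE mulrC.
  have FM : \sum_s \sum_t `|M s t| ^+ 2 <= (n ^ d)%:R * B.
    have -> : (n ^ d)%:R * B = \sum_(s : {ffun 'I_d -> 'I_n}) B.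
      by rewrite sumr_const card_ffun !card_ord mulr_natl.
    apply: ler_sum => s _.
    (* In a fixed row of [M] the arguments of [f] are distinct points, so the l^2 bound controls the
       row. *)
    pose l := [seq x0 - corner b + corner s | b : {ffun 'I_d -> 'I_n}].
    have ul : uniq l.
      rewrite map_inj_uniq ?enum_uniq // => b c /addIr/addrI/oppr_inj.
      exact: corner_inj.
    apply: le_trans (fB l ul); rewrite big_image /=.
    apply: ler_sum => t _; rewrite (bigD1 i0) //= /M /g lerDl.
    by rewrite sumr_ge0 // => i _; rewrite exprn_ge0.
  set K := #|_|%:R in tr.
  have nd0 : 0 < (n ^ d)%:R :> C by rewrite ltr0n expn_gt0 n0.
  have Kn : K * n%:R <= (4 * m * d * D)%:R * (n ^ d)%:R.
    by rewrite /K -!natrM ler_nat card_boundary.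
  have K0 : 0 <= K by rewrite ler0n.
  (* The goal is scaled by n^(2d) to match the trace inequality; the remaining factor n is supplied
     by [card_boundary]. *)
  rewrite -(ler_pM2l nd0) -(ler_pM2l nd0).
  rewrite trM normrM normr_nat exprMn in tr.
  have := ler_wpM2r (ler0n C n) (le_trans tr (ler_wpM2l K0 FM)).
  set N := (n ^ d)%:R in nd0 Kn tr * => tr'.
  have := ler_wpM2r (mulr_ge0 (ltW nd0) B0) Kn => Kn'.
  have E1 : N * (N * (n%:R * `|f x0 i0 0| ^+ 2)) = N ^+ 2 * `|f x0 i0 0| ^+ 2 * n%:R by ring.
  have E2 : N * (N * ((4 * m * d * D)%:R * B)) = (4 * m * d * D)%:R * N * (N * B) by ring.
  rewrite E1 E2; apply: le_trans tr' _; apply: le_trans Kn'.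
  by rewrite le_eqVlt; apply/orP; left; apply/eqP; ring.
have q0 : 0 < `|f x0 i0 0| ^+ 2 by rewrite exprn_gt0 ?normr_gt0.
have [|n] := archi ((4 * m * d * D)%:R * B / `|f x0 i0 0| ^+ 2).
  by rewrite divr_ge0 ?mulr_ge0 ?ler0n // ltW.
rewrite ltr_pdivrMr // => Bn.
have /bound : (0 < n)%N.
  by case: n Bn => //; rewrite mul0r => /lt_geF; rewrite mulr_ge0 ?ler0n.
by move=> /le_lt_trans/(_ Bn); rewrite ltxx.
Qed.

End Eigenfunctions.

(** * The Cayley transform *)

Section Cayley.
Variables (C : numClosedFieldType) (D : nat) (I : eqType) (S : seq I) (P : I -> 'M[C]_D).
Hypothesis S_uniq : uniq S.
Hypothesis P_idem : forall a, a \in S -> P a *m P a = P a.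
Hypothesis P_orth : forall a b, a \in S -> b \in S -> a != b -> P a *m P b = 0.
Hypothesis P_sum1 : \sum_(a <- S) P a = 1%:M.

(** Functional calculus of the resolution of unity: scalar identities in the [w a] become identities
    between the matrices of the Cayley transform. *)
Lemma resolution_mul (g h : I -> C) :
  (\sum_(a <- S) g a *: P a) *m (\sum_(a <- S) h a *: P a) =
  \sum_(a <- S) (g a * h a) *: P a.
Proof.
rewrite mulmx_suml; apply: eq_big_seq => a aS; rewrite mulmx_sumr.
rewrite (bigD1_seq a) //= big_seq_cond big1 => [|b /andP[bS ba]].
  by rewrite -scalemxAl -scalemxAr scalerA P_idem // addr0.
by rewrite -scalemxAl -scalemxAr P_orth 1?eq_sym // !scaler0.
Qed.

(** Here E (1 + V) = 1 - V and V (1 + E) = 1 - E. Given psi, the vector phi = psi - E psi has K phi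
    = psi + E psi, hence V K phi = phi. Given phi, put chi = K phi: the sum chi + phi is fixed by K,
    and E maps it to chi - phi, which K negates. *)
Lemma cayley_fixed_vector (K : 'M[C]_D) (w : I -> C) :
    K *m K = 1%:M -> (forall a, a \in S -> 1 + w a != 0) ->
  let V := \sum_(a <- S) w a *: P a in
  let E := \sum_(a <- S) ((1 - w a) / (1 + w a)) *: P a in
  (exists psi : 'cV_D, [/\ psi != 0, K *m psi = psi & K *m (E *m psi) = - (E *m psi)])
  <-> (exists2 phi : 'cV_D, phi != 0 & phi = V *m K *m phi).
Proof.
move=> KK w1 V E; pose W := \sum_(a <- S) (1 + w a) *: P a.
have V1 : 1%:M + V = W.
  by rewrite -P_sum1 -big_split; apply: eq_bigr => a _; rewrite scalerDl scale1r.
have EW : E *m W = 1%:M - V.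
  rewrite resolution_mul -P_sum1 -sumrB; apply: eq_big_seq => a aS.
  by rewrite divfK ?w1 // scalerBl scale1r.
have VE : V *m (1%:M + E) = 1%:M - E.
  rewrite mulmxDr mulmx1 resolution_mul -P_sum1 -sumrB -big_split.
  apply: eq_big_seq => a aS /=; rewrite -scalerDl -{2}[P a]scale1r -scalerBl.
  by congr (_ *: _); have := w1 a aS => ?; field.
split=> [[psi [psi0 Kpsi KEpsi]]|[phi phi0 phiE]].
  exists (psi - E *m psi).
    apply: contra_neq psi0 => /eqP; rewrite subr_eq0 => /eqP psiE.
    have : psi + psi = 0 by rewrite -{1}Kpsi {1}psiE KEpsi -psiE addNr.
    by move/eqP; rewrite -mulr2n -scaler_nat scaler_eq0 pnatr_eq0 => /eqP.
  rewrite -mulmxA mulmxBr Kpsi KEpsi opprK -{3}[psi]mul1mx -mulmxDl mulmxA VE.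
  by rewrite mulmxBl mul1mx.
have KKphi : K *m (K *m phi) = phi by rewrite mulmxA KK mul1mx.
pose chi := K *m phi; have Vchi : V *m chi = phi by rewrite mulmxA -phiE.
have Echi : E *m (chi + phi) = chi - phi.
  by rewrite -{1}Vchi -{1}[chi]mul1mx -mulmxDl V1 mulmxA EW mulmxBl mul1mx Vchi.
exists (chi + phi); split.
(* chi + phi = (1 + V) chi, and 1 + V is invertible because no [1 + w a] vanishes. *)
- apply: contra_neq phi0 => chiphi.
  have W0 : W *m chi = 0 by rewrite -V1 mulmxDl mul1mx Vchi.
  suff chi0 : chi = 0 by rewrite -KKphi -/chi chi0 mulmx0.
  rewrite -[chi]mul1mx; suff <- : (\sum_(a <- S) (1 + w a)^-1 *: P a) *m W = 1%:M.
    by rewrite -mulmxA W0 mulmx0.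
  rewrite resolution_mul -P_sum1; apply: eq_big_seq => a aS.
  by rewrite mulVf ?w1 // scale1r.
- by rewrite mulmxDr KKphi addrC.
- by rewrite Echi mulmxBr KKphi opprB.
Qed.

End Cayley.

(** * Walks with an involutive coin *)

Section QuantumWalk.
Variables (C : numClosedFieldType) (d D : nat).
Variables (S : seq (lattice d)) (P : lattice d -> 'M[C]_D) (K : 'M[C]_D).
Hypothesis archi : forall x : C, 0 <= x -> exists n : nat, x < n%:R.
Hypothesis S_uniq : uniq S.
Hypothesis P_idem : forall a, a \in S -> P a *m P a = P a.
Hypothesis P_orth : forall a b, a \in S -> b \in S -> a != b -> P a *m P b = 0.
Hypothesis P_sum1 : \sum_(a <- S) P a = 1%:M.
Hypothesis KK : K *m K = 1%:M.

Definition square_summable (f : lattice d -> 'cV[C]_D) :=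
  exists B : C, forall s, uniq s -> \sum_(x <- s) \sum_i `|f x i 0| ^+ 2 <= B.

Lemma finite_square_summable (s : seq (lattice d)) (f : lattice d -> 'cV[C]_D) :
  (forall x, x \notin s -> f x = 0) -> square_summable f.
Proof.
move=> fs; pose g x := \sum_i `|f x i 0| ^+ 2.
have g0 x : 0 <= g x by rewrite sumr_ge0 // => i _; rewrite exprn_ge0.
exists (\sum_(x <- undup s) g x) => t ut.
pose u := undup (s ++ t); pose g' x := if x \in t then g x else 0.
have -> : \sum_(x <- undup s) g x = \sum_(x <- u) g x.
  symmetry; apply: big_support_seq; rewrite ?undup_uniq // => x.
    by rewrite !mem_undup mem_cat => ->.
  rewrite mem_undup => /fs fx0; apply: big1 => i _.
  by rewrite fx0 mxE normr0 expr0n.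
have -> : \sum_(x <- t) \sum_i `|f x i 0| ^+ 2 = \sum_(x <- u) g' x.
  rewrite [RHS](@big_support_seq _ _ t) ?undup_uniq //.
  - by apply: eq_big_seq => x xt; rewrite /g' xt.
  - by move=> x xt; rewrite mem_undup mem_cat xt orbT.
  - by move=> x xt; rewrite /g' (negbTE xt).
by apply: ler_sum => x _; rewrite /g'; case: ifP.
Qed.

(** [K] will be C or - C, so that the eigenvalue 1 covers both parts of the theorem. *)
Lemma stationary_iff_eta :
  (exists f, [/\ square_summable f, exists x, f x != 0
               & stationary S (fun a => P a *m K) f]) <->
  (forall z, (forall j, `|z j| = 1) -> (forall a, a \in S -> 1 + monomial z a != 0) ->
     let E := \sum_(a <- S) ((1 - monomial z a) / (1 + monomial z a)) *: P a in
     exists psi : 'cV_D,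
       [/\ psi != 0, K *m psi = psi & K *m (E *m psi) = - (E *m psi)]).
Proof.
have symE z : symbol S (fun a => P a *m K) z = (\sum_(a <- S) monomial z a *: P a) *m K.
  by rewrite mulmx_suml; apply: eq_bigr => a _; rewrite scalemxAl.
split=> [[f [[B fB] fn0 fP]] z z1 zS E|hz].
  have [h [s [hP hs hn0]]] := finite_stationary_of_l2 archi fP fB fn0.
  apply/(cayley_fixed_vector S_uniq P_idem P_orth P_sum1 KK zS); rewrite -symE.
  apply: symbol_fixed_vector hP hs hn0 => j.
  by rewrite -normr_eq0 z1 oner_eq0.
have [|h [s [hP hs hn0]]] := @finite_stationary_of_symbol _ _ _ S (fun a => P a *m K).
  move=> n z n_odd zn; rewrite symE.
  (* z^a is an n-th root of unity, whereas (-1)^n = -1 for odd n. *)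
  have zS a : a \in S -> 1 + monomial z a != 0.
    move=> _; have mn : monomial z a ^+ n = 1.
      rewrite -prodrXl big1 // => j _.
      by rewrite exprnP exprz_exp mulrC -exprz_exp -exprnP zn exp1rz.
    apply: contraTneq (oner_neq0 C) => /eqP; rewrite addrC addr_eq0 => /eqP m1.
    have : (1 : C) = -1 by rewrite -{1}mn m1 -signr_odd n_odd expr1.
    by move/eqP; rewrite -subr_eq0 opprK (pnatr_eq0 C 2).
  apply/(cayley_fixed_vector S_uniq P_idem P_orth P_sum1 KK zS); apply: hz zS => j.
  apply/eqP; rewrite -(@pexpr_eq1 _ _ n) ?normr_ge0 -?normrX ?zn ?normr1 //.
  by case: n n_odd {zn}.
by exists h; split=> //; apply: finite_square_summable hs.
Qed.

End QuantumWalk.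

(** * Transfer to the concrete definitions *)

Section Bridge.
Definition CC : numClosedFieldType := complex Rdefinitions.R.

Definition toC (a : Cx) : CC := Complex (Cre a) (Cim a).
Definition ofC (a : CC) : Cx := Cmk (complex.Re a) (complex.Im a).

Lemma toCK : cancel toC ofC. Proof. by case. Qed.
Lemma ofCK : cancel ofC toC. Proof. by case. Qed.

Lemma toC1 : toC Cone = 1. Proof. by []. Qed.
Lemma toCD a b : toC (Cadd a b) = toC a + toC b. Proof. by []. Qed.
Lemma toCN a : toC (Copp a) = - toC a. Proof. by []. Qed.
Lemma toCM a b : toC (Cmul a b) = toC a * toC b. Proof. by []. Qed.

Lemma toCV a : toC (Cinv a) = (toC a)^-1.
Proof.
by case: a => x y; rewrite /toC /Cinv /Cabs2 /= !RdivE RoppE mulNr.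
Qed.

Lemma toC_norm a : ((Cabs2 a)%:C)%C = `|toC a| ^+ 2.
Proof.
rewrite sqr_normc; case: a => x y; apply/eqP; rewrite eq_complex /=.
by rewrite mulrN opprK mulrN [y * x]mulrC addNr !eqxx.
Qed.

Lemma toC_norm1 a : Cabs2 a = 1%R <-> `|toC a| = 1.
Proof.
split=> [a1|a1].
  by apply/eqP; rewrite -(@pexpr_eq1 _ _ 2) ?normr_ge0 // -toC_norm a1.
by have := toC_norm a; rewrite a1 expr1n => -[].
Qed.

Lemma toC_pow a n : toC (Cpow a n) = toC a ^+ n.
Proof. by elim: n => [|n IH] //=; rewrite toCM IH exprS. Qed.

Lemma toC_powz a k : toC (Cpowz a k) = toC a ^ int_of_Z k.
Proof.
case: k => [|p|p] //=; first by rewrite toC_pow.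
(* [Negz k] is -(k + 1), hence a predecessor to undo. *)
rewrite toCV toC_pow NegzE -exprnN prednK //; lia.
Qed.

Lemma toC_csum n F : toC (csum n F) = \sum_(i < n) toC (F i).
Proof. by elim: n => [|n IH]; rewrite ?big_ord0 // big_ord_recr -IH. Qed.

Lemma InP (T : eqType) (x : T) (s : seq T) : reflect (List.In x s) (x \in s).
Proof.
elim: s => [|y s IH]; first by constructor.
rewrite inE; apply: (iffP orP) => [[/eqP->|/IH]|[->|/IH]]; by [left | right].
Qed.

Lemma NoDupP (T : eqType) (s : seq T) : reflect (List.NoDup s) (uniq s).
Proof.
elim: s => [|y s IH]; first by do 2!constructor.
apply: (iffP andP) => [[/InP ys /IH us]|ys]; first by constructor.
by inversion ys; split; [apply/InP | apply/IH].
Qed.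

Section Dim.
Variables d D : nat.

Definition toV (v : Vec) : 'cV[CC]_D := \col_i toC (v i).
Definition ofV (v : 'cV[CC]_D) : Vec :=
  fun i => if insub i is Some j then ofC (v j 0) else Czero.
Definition toM (A : Mat) : 'M[CC]_D := \matrix_(i, j) toC (A i j).

Lemma ofVK : cancel ofV toV.
Proof.
by move=> v; apply/colP => i; rewrite mxE /ofV valK ofCK.
Qed.

Lemma veqP v w : veq D v w <-> toV v = toV w.
Proof.
split=> [vw|/colP vw i iD].
  by apply/colP => i; rewrite !mxE vw //; apply/ssrnat.ltP.
by have := vw (Ordinal (introT ssrnat.ltP iD)); rewrite !mxE => /(can_inj toCK).
Qed.

Lemma meqP A B : meq D A B <-> toM A = toM B.
Proof.
split=> [AB|/matrixP AB i j iD jD].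
  by apply/matrixP => i j; rewrite !mxE AB //; apply/ssrnat.ltP.
have := AB (Ordinal (introT ssrnat.ltP iD)) (Ordinal (introT ssrnat.ltP jD)).
by rewrite !mxE => /(can_inj toCK).
Qed.

Lemma vnonzeroP v : vnonzero D v <-> toV v != 0.
Proof.
split=> [[i [iD vi]]|/cV0Pn[k]].
  apply/cV0Pn; exists (Ordinal (introT ssrnat.ltP iD)); rewrite mxE.
  by apply: contra_notN vi => /eqP vi; apply: (can_inj toCK).
rewrite mxE => vk; exists k; split; first exact/ssrnat.ltP.
by move=> vk0; rewrite vk0 eqxx in vk.
Qed.

Lemma toV_mv A v : toV (mv D A v) = toM A *m toV v.
Proof.
by apply/colP => i; rewrite !mxE toC_csum; apply: eq_bigr => j _; rewrite !mxE toCM.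
Qed.

Lemma toM_mm A B : toM (mm D A B) = toM A *m toM B.
Proof.
by apply/matrixP => i j; rewrite !mxE toC_csum; apply: eq_bigr => k _; rewrite !mxE toCM.
Qed.

Lemma toM_Ident : toM Ident = 1%:M.
Proof.
apply/matrixP => i j; rewrite !mxE /Ident -val_eqE /=.
by have -> : Nat.eqb i j = (i == j :> nat) by []; case: eqP.
Qed.

Lemma toM_Zero : toM Zero = 0.
Proof. by apply/matrixP => i j; rewrite !mxE. Qed.

Lemma toV_scale c v : toV (vscale c v) = toC c *: toV v.
Proof. by apply/colP => i; rewrite !mxE toCM. Qed.

Lemma toM_scale c A : toM (mscale c A) = toC c *: toM A.
Proof. by apply/matrixP => i j; rewrite !mxE toCM. Qed.

Lemma toM_msum (T : Type) (s : seq T) F :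
  toM (msum_list s F) = \sum_(a <- s) toM (F a).
Proof.
elim: s => [|a s IH]; first by rewrite big_nil toM_Zero.
by rewrite big_cons -IH; apply/matrixP => i j; rewrite !mxE -toCD.
Qed.

Lemma toV_vsum (T : Type) (s : seq T) F :
  toV (vsum_list s F) = \sum_(a <- s) toV (F a).
Proof.
elim: s => [|a s IH]; first by rewrite big_nil; apply/colP => i; rewrite !mxE.
by rewrite big_cons -IH; apply/colP => i; rewrite !mxE -toCD.
Qed.

Lemma toC_vnorm2 v : ((vnorm2 D v)%:C)%C = \sum_i `|toV v i 0| ^+ 2.
Proof.
under eq_bigr do rewrite mxE -toC_norm.
rewrite /vnorm2; elim: (D) => [|n IH]; first by rewrite big_ord0.
by rewrite big_ord_recr -IH /= -rmorphD.
Qed.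

Definition toX (l : Zd) : lattice d := [ffun j : 'I_d => int_of_Z (nth Z0 l j)].
Definition ofX (x : lattice d) : Zd := [seq Z_of_int (x j) | j : 'I_d].

Lemma ofX_in x : in_Zd d (ofX x).
Proof. by rewrite /in_Zd -[length _]/(size _) size_map size_enum_ord. Qed.

Lemma ofXK : cancel ofX toX.
Proof.
move=> x; apply/ffunP => j; rewrite ffunE (nth_map j) ?size_enum_ord //.
by rewrite nth_ord_enum Z_of_intK.
Qed.

Lemma toXK l : in_Zd d l -> ofX (toX l) = l.
Proof.
move=> ld; apply: (@eq_from_nth _ Z0).
  by rewrite -[size _]/(length _) ofX_in.
move=> i; rewrite -[size _]/(length _) ofX_in => id.
rewrite (nth_map (Ordinal id)) ?size_enum_ord // ffunE int_of_ZK.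
by rewrite nth_enum_ord.
Qed.

Lemma zsub_in x a : in_Zd d x -> in_Zd d (zsub x a).
Proof.
move=> <-; elim: x a => [|x0 x IH] [|a0 a] //=.
by rewrite /in_Zd /= IH.
Qed.

Lemma toX_zsub x a : in_Zd d x -> in_Zd d a -> toX (zsub x a) = toX x - toX a.
Proof.
move=> xd ad; apply/ffunP => j; rewrite !ffunE -raddfB; congr int_of_Z.
(* [zsub] keeps the remaining entries of [x] once [a] is exhausted, so the induction carries the
   equality of lengths. *)
have : size x = size a by rewrite -[RHS]/(length a) ad.
elim: x a (nat_of_ord j) {xd ad} => [|x0 x IH] [|a0 a] [|k] //= [] // xa.
exact: IH.
Qed.

Lemma zmon_auxE z k a : toC (zmon_aux z k a) =
  \prod_(j < size a) toC (z (k + j)%N) ^ int_of_Z (nth Z0 a j).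
Proof.
elim: a k => [|n a IH] k; first by rewrite big_ord0.
rewrite big_ord_recl addn0 /= toCM toC_powz IH; congr (_ * _).
by apply: eq_bigr => j _; rewrite /= /bump addnS.
Qed.

Lemma zmonE z a : in_Zd d a ->
  toC (zmon z a) = monomial (fun j : 'I_d => toC (z j)) (toX a).
Proof.
move=> ad; rewrite /zmon zmon_auxE; have -> : size a = d by [].
by apply: eq_bigr => j _; rewrite ffunE add0n.
Qed.

Lemma archiCC (x : CC) : 0 <= x -> exists n : nat, x < n%:R.
Proof.
case: x => x y; rewrite lecE /= => /andP[/eqP-> x0].
exists (Num.bound x); rewrite -(rmorph_nat (real_complex _)) ltcR.
exact: archi_boundP.
Qed.

Lemma toC_fold_vnorm2 (f : Fld) (L : seq Zd) :
  ((fold_right (fun x acc => Rplus (vnorm2 D (f x)) acc) (IZR 0) L)%:C)%C =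
  \sum_(x <- L) \sum_i `|toV (f x) i 0| ^+ 2.
Proof.
elim: L => [|x L IH]; first by rewrite big_nil.
by rewrite big_cons -IH -toC_vnorm2 -rmorphD.
Qed.

Lemma l2P f : l2 d D f <-> square_summable (fun x : lattice d => toV (f (ofX x))).
Proof.
split=> [[M fM]|[B fB]].
  exists (M%:C)%C => s us.
  rewrite -(big_map (@ofX) xpredT (fun l => \sum_i `|toV (f l) i 0| ^+ 2)).
  rewrite -toC_fold_vnorm2 lecR; apply/RleP; apply: fM.
    by apply/NoDupP; rewrite map_inj_uniq //; apply: can_inj ofXK.
  by apply/List.Forall_forall => l /InP/mapP[x _ ->]; apply: ofX_in.
(* The bound is complex; the real sums are compared with its real part. *)
exists (complex.Re B) => L /NoDupP uL /List.Forall_forall Ld.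
have uX : uniq (map toX L).
  rewrite map_inj_in_uniq // => x y /InP/Ld xd /InP/Ld yd xy.
  by rewrite -(toXK xd) xy toXK.
have := fB _ uX; rewrite big_map.
under eq_big_seq => x xL do rewrite (toXK (Ld _ (InP _ _ xL))).
by rewrite -toC_fold_vnorm2 lecE => /andP[_ /RleP].
Qed.

(** * Eigenvalues lam with lam^2 = 1 *)

Section Eigenvalue.
Variables (S : list Zd) (P : Zd -> Mat) (Cm : Mat) (lam : Cx).
Hypothesis finS : finite_subset d S.
Hypothesis resP : resolution_of_unity D S P.
Hypothesis invC : meq D (mm D Cm Cm) Ident.
Hypothesis lam2 : toC lam * toC lam = 1.

Let S' := map toX S.
Let P' a := toM (P (ofX a)).
(** As lam^2 = 1, multiplication by lam turns U f = lam f into a fixed-point equation with coin [K],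
    and the eigenspaces of C for lam and -lam into those of [K] for 1 and -1. *)
Let K := toC lam *: toM Cm.

Lemma S_in a : a \in S -> in_Zd d a.
Proof. by case: finS => _ /List.Forall_forall Sd /InP/Sd. Qed.

Lemma big_S' (V : nmodType) (F : lattice d -> V) :
  \sum_(a <- S') F a = \sum_(a <- S) F (toX a).
Proof. by rewrite big_map. Qed.

Lemma P'E a : a \in S -> P' (toX a) = toM (P a).
Proof. by move=> aS; rewrite /P' toXK //; apply: S_in. Qed.

Lemma S'_uniq : uniq S'.
Proof.
rewrite map_inj_in_uniq; first by apply/NoDupP; case: finS.
by move=> x y /S_in xd /S_in yd xy; rewrite -(toXK xd) xy toXK.
Qed.

Lemma P'_idem a : a \in S' -> P' a *m P' a = P' a.
Proof.
case/mapP => b bS ->; rewrite P'E // -toM_mm; apply/meqP.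
by case: resP => /(_ b (InP _ _ bS)) [].
Qed.

Lemma P'_orth a b : a \in S' -> b \in S' -> a != b -> P' a *m P' b = 0.
Proof.
case/mapP => x xS -> /mapP[y yS ->] xy; rewrite !P'E // -toM_mm -toM_Zero.
apply/meqP; case: resP => _ [orth _]; apply: orth; try exact/InP.
by move=> xyE; rewrite xyE eqxx in xy.
Qed.

Lemma P'_sum1 : \sum_(a <- S') P' a = 1%:M.
Proof.
rewrite big_S' -toM_Ident; case: resP => _ [_ /meqP <-]; rewrite toM_msum.
by apply: eq_big_seq => a aS; rewrite P'E.
Qed.

Lemma KK : K *m K = 1%:M.
Proof.
rewrite /K -scalemxAl -scalemxAr scalerA lam2 scale1r -toM_mm -toM_Ident.
exact/meqP.
Qed.

Lemma lam_scaleP (u v : 'cV[CC]_D) : u = toC lam *: v <-> toC lam *: u = v.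
Proof. by split=> [->|<-]; rewrite scalerA lam2 scale1r. Qed.

Lemma eigspP psi : in_eigsp D Cm lam psi <-> K *m toV psi = toV psi.
Proof.
rewrite /in_eigsp; split=> [/veqP|H].
  by rewrite toV_mv toV_scale => /lam_scaleP; rewrite /K -scalemxAl.
by apply/veqP; rewrite toV_mv toV_scale; apply/lam_scaleP; rewrite scalemxAl.
Qed.

Lemma eigspNP psi : in_eigsp D Cm (Copp lam) psi <-> K *m toV psi = - toV psi.
Proof.
rewrite /in_eigsp; split=> [/veqP|H].
  rewrite toV_mv toV_scale toCN scaleNr -scalerN => /lam_scaleP.
  by rewrite /K -scalemxAl.
apply/veqP; rewrite toV_mv toV_scale toCN scaleNr -scalerN; apply/lam_scaleP.
by rewrite scalemxAl.
Qed.

Lemma eigenfunctionP f :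
  (forall x, in_Zd d x -> veq D (Uop D S P Cm f x) (vscale lam (f x))) <->
  stationary S' (fun a => P' a *m K) (fun x => toV (f (ofX x))).
Proof.
have UE x : in_Zd d x -> toC lam *: toV (Uop D S P Cm f x) =
    \sum_(a <- S') P' a *m K *m toV (f (ofX (toX x - a))).
  move=> xd; rewrite big_S' toV_vsum scaler_sumr; apply: eq_big_seq => a aS.
  rewrite P'E // !toV_mv /K -(toX_zsub xd (S_in aS)) (toXK (zsub_in a xd)).
  by rewrite -scalemxAr -scalemxAl mulmxA.
split=> [fP x|fP x xd].
  have xd := ofX_in x; have /veqP := fP _ xd.
  by rewrite toV_scale => /lam_scaleP; rewrite UE // ofXK.
by apply/veqP; rewrite toV_scale; apply/lam_scaleP; rewrite UE // -fP toXK.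
Qed.

Lemma toM_eta z : toM (eta S P z) = \sum_(a <- S')
  ((1 - monomial (fun j : 'I_d => toC (z j)) a) /
   (1 + monomial (fun j : 'I_d => toC (z j)) a)) *: P' a.
Proof.
rewrite big_S' toM_msum; apply: eq_big_seq => a aS.
by rewrite toM_scale P'E // toCM toCV !toCD toCN toC1 (zmonE _ (S_in aS)).
Qed.

Lemma in_EP z : ~ in_E S z <->
  forall a, a \in S' -> 1 + monomial (fun j : 'I_d => toC (z j)) a != 0.
Proof.
split=> [zE b /mapP[a aS ->]|zE [a [/InP aS za]]].
  rewrite addrC addr_eq0; apply: contra_notN zE => /eqP za; exists a.
  split; first exact/InP.
  by apply: (can_inj toCK); rewrite (zmonE _ (S_in aS)) za toCN toC1.
have := zE (toX a) (map_f _ aS).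
by rewrite -(zmonE _ (S_in aS)) za toCN toC1 subrr eqxx.
Qed.

Lemma in_torusP z : in_torus d z <-> forall j : 'I_d, `|toC (z j)| = 1.
Proof.
split=> [zT j|zT j jd]; first by apply/toC_norm1/zT/ssrnat.ltP.
by apply/toC_norm1; apply: (zT (Ordinal (introT ssrnat.ltP jd))).
Qed.

Lemma eigenvalue_iff_eta : has_eigenvalue d D S P Cm lam <->
  (forall z, in_torus d z -> ~ in_E S z ->
     exists psi : Vec, vnonzero D psi /\ in_eigsp D Cm lam psi /\
       in_eigsp D Cm (Copp lam) (mv D (eta S P z) psi)).
Proof.
have main := stationary_iff_eta archiCC S'_uniq P'_idem P'_orth P'_sum1 KK.
split=> [[f [f2 [[x [xd fx0]] fP]]] z /in_torusP zT /in_EP zE|hz].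
  have [] := main.1 _ _ zT zE.
    exists (fun x => toV (f (ofX x))); split; first exact/l2P.
      by exists (toX x); rewrite toXK //; apply/vnonzeroP.
    exact/eigenfunctionP.
  move=> psi [psi0 Kpsi KEpsi]; exists (ofV psi); split.
    by apply/vnonzeroP; rewrite ofVK.
  by split; [apply/eigspP | apply/eigspNP]; rewrite ?toV_mv ofVK ?toM_eta.
have [|f [f2 [x fx0] fP]] := main.2.
  (* The point [w], with d coordinates, is extended by 1 to all natural indices. *)
  move=> w w1 wE; pose z j := oapp (ofC \o w) Cone (insub j).
  have zw : (fun j : 'I_d => toC (z j)) = w.
    by apply: functional_extensionality => j; rewrite /z valK /= ofCK.
  have [||psi [psi0 [psi1 psiN]]] := hz z.
  - by apply/in_torusP => j; have := w1 j; rewrite -zw.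
  - by apply/in_EP; rewrite zw.
  exists (toV psi); split; [exact/vnonzeroP | exact/eigspP |].
  by move/eigspNP: psiN; rewrite toV_mv toM_eta zw.
exists (fun l => ofV (f (toX l))).
have fE : (fun x => toV (ofV (f (toX (ofX x))))) = f.
  by apply: functional_extensionality => y; rewrite ofXK ofVK.
split; first by apply/l2P; rewrite fE.
split; last by apply/eigenfunctionP; rewrite fE.
by exists (ofX x); split; [exact: ofX_in | apply/vnonzeroP; rewrite ofXK ofVK].
Qed.

End Eigenvalue.
End Dim.
End Bridge.

Theorem theorem3p1 (d D : nat) (S : list Zd) (P : Zd -> Mat) (Cm : Mat) :
  finite_subset d S ->
  resolution_of_unity D S P ->
  unitary D Cm ->
  meq D (mm D Cm Cm) Ident ->
  ~ is_scalar D Cm ->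
  (has_eigenvalue d D S P Cm Cone <->
     (forall z, in_torus d z -> ~ in_E S z ->
        exists psi : Vec, vnonzero D psi /\ in_eigsp D Cm Cone psi /\
          in_eigsp D Cm (Copp Cone) (mv D (eta S P z) psi)))
  /\
  (has_eigenvalue d D S P Cm (Copp Cone) <->
     (forall z, in_torus d z -> ~ in_E S z ->
        exists psi : Vec, vnonzero D psi /\ in_eigsp D Cm (Copp Cone) psi /\
          in_eigsp D Cm Cone (mv D (eta S P z) psi))).
Proof.
move=> finS resP _ invC _.
have CoppK : Copp (Copp Cone) = Cone by apply: (can_inj toCK); rewrite !toCN opprK.
split; first by apply: eigenvalue_iff_eta; rewrite // toC1 mulr1.
(* Part (b) is the case lam = -1: the eigenvalue 1 of the last eigenspace is rewritten as -(-1) to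
   match [Copp lam]. *)
rewrite -{3}CoppK; apply: eigenvalue_iff_eta => //.
by rewrite toCN toC1 mulrNN mulr1.
Qed.
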